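(* Given any non-squarefree integer $b\ge 5$, there exists an integer $a$ with $1<a<b$ such that $p_{a,b}(n)$ is not of the form $$p_{a,b}(n)=cn+d,\qquad n=1,2,\dots$$ for some integers $c\ge 1$ and $d$; that is, there are no integers $c\ge1$ and $d$ for which this identity holds for all $n\ge 1$.
   Context: For an integer $b\ge 3$ and a real $x>0$, the leading digit $D_b(x)\in\{1,2,\dots,b-1\}$ of $x$ in base $b$ is defined by: $D_b(x)=d$ if and only if $d\cdot b^j\le x<(d+1)b^j$ for some $j\in\mathbb{Z}$. For real $a>0$, the leading digit sequence is $S_{a,b}=\{D_b(a^n)\}_{n=1}^\infty$. Its (block) complexity function is $$p_{a,b}(n)=\#\{(D_b(a^m),D_b(a^{m+1}),\dots,D_b(a^{m+n-1})): m=1,2,\dots\},$$ the number of distinct blocks of $n$ consecutive terms occurring in $S_{a,b}$. *)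

(* Defs.v *)
From mathcomp Require Import all_boot all_order all_algebra finmap.
From mathcomp Require Import boolp classical_sets cardinality reals.

Set Implicit Arguments.
Unset Strict Implicit.
Unset Printing Implicit Defensive.

Import Order.TTheory GRing.Theory Num.Theory.

Local Open Scope classical_set_scope.
Local Open Scope ring_scope.

Definition squarefree (n : nat) : Prop :=
  forall d : nat, (d ^ 2 %| n)%N -> d = 1%N.

Definition is_leading_digit (R : realType) (b : nat) (x : R) (d : nat) : Prop :=
  (1 <= d < b)%N /\
  exists j : int, d%:R * b%:R ^ j <= x < d.+1%:R * b%:R ^ j.

(* The value 0 is only taken when no leading digit exists; by [leading_digitP]
   this does not happen for 1 < b and 0 < x. *)
Definition leading_digit (R : realType) (b : nat) (x : R) : nat :=
  xget 0%N [set d | is_leading_digit b x d].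

Definition lead_block (R : realType) (a : R) (b n m : nat) : seq nat :=
  [seq leading_digit b (a ^+ (m + i)) | i <- iota 0 n].

Definition lead_blocks (R : realType) (a : R) (b n : nat) : set (seq nat) :=
  [set lead_block a b n m | m in [set m | (1 <= m)%N]].

(* [fset_set] is meaningful because of [finite_lead_blocks]. *)
Definition complexity (R : realType) (a : R) (b n : nat) : nat :=
  #|` fset_set (lead_blocks a b n)|%fset.

Lemma leading_digit_lt (R : realType) (b : nat) (x : R) :
  (leading_digit b x < b.+1)%N.
Proof.
rewrite /leading_digit; case: xgetP => [d _ [/andP[_ /ltnW]]|_] //.
Qed.

Lemma finite_lead_blocks (R : realType) (a : R) (b n : nat) :
  finite_set (lead_blocks a b n).
Proof.
apply: (@sub_finite_set _ _
  [set [seq nat_of_ord d | d <- t] | t in [set: n.-tuple 'I_b.+1]]).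
  move=> _ [m _ <-].
  exists [tuple Ordinal (leading_digit_lt b (a ^+ (m + i))) | i < n] => //.
  by rewrite /lead_block -val_enum_ord -!map_comp; apply: eq_map.
exact: finite_image.
Qed.

Lemma exists_scale (R : realType) (b : nat) (x : R) : (1 < b)%N -> 0 < x ->
  exists j : int, b%:R ^ j <= x < b%:R ^ (j + 1).
Proof.
move=> b1 x0.
have b0 : (0 : R) < b%:R by rewrite ltr0n ltnW.
have bn0 : (b%:R : R) != 0 by rewrite gt_eqF.
have bnd (y : R) : 0 < y -> exists k : nat, y < b%:R ^+ k.
  move=> y0; exists (Num.bound y); apply: (@lt_trans _ _ (Num.bound y)%:R).
    exact: archi_boundP (ltW y0).
  by rewrite -natrX ltr_nat ltn_expl.
have [k xk] := bnd _ x0.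
have [l xl] : exists l, x^-1 < b%:R ^+ l by apply: bnd; rewrite invr_gt0.
have lx : b%:R ^+ l * x > 1 by rewrite -ltr_pdivrMr // div1r.
have bl0 : 0 < (b%:R : R) ^+ l by rewrite exprn_gt0.
have xP : exists i : nat, b%:R ^+ l * x < b%:R ^+ i.
  by exists (l + k)%N; rewrite exprD ltr_pM2l.
have [i xi imin] := ex_minnP xP.
case: i xi imin => [|i] xi imin.
  by move: (lt_trans lx xi); rewrite expr0 ltxx.
exists (i%:Z - l%:Z).
have -> : i%:Z - l%:Z + 1 = i.+1%:Z - l%:Z by rewrite -addn1 PoszD addrAC.
rewrite !expfzDr // -!invr_expz -!exprnP.
rewrite ler_pdivrMr // ltr_pdivlMr // ![x * _]mulrC.
rewrite xi andbT leNgt; apply/negP => /imin.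
by rewrite ltnn.
Qed.

Lemma leading_digit_exists (R : realType) (b : nat) (x : R) :
  (1 < b)%N -> 0 < x -> exists d, is_leading_digit b x d.
Proof.
move=> b1 x0; have [j /andP[jx xj]] := exists_scale b1 x0.
have b0 : (0 : R) < b%:R by rewrite ltr0n ltnW.
have bj0 : 0 < (b%:R : R) ^ j by rewrite exprz_gt0.
have y0 : 0 <= x / b%:R ^ j by rewrite divr_ge0 // ltW.
exists (Num.truncn (x / b%:R ^ j)); split; last first.
  exists j; rewrite -ler_pdivlMr // -ltr_pdivrMr //.
  exact: truncn_itv.
apply/andP; split; first by rewrite truncn_gt0 ler_pdivlMr // mul1r.
rewrite -(ltr_nat R); apply: (@le_lt_trans _ _ (x / b%:R ^ j)).
  by case/andP: (truncn_itv y0).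
by rewrite ltr_pdivrMr // -{1}[b%:R]expr1z -expfzDr ?gt_eqF // addrC.
Qed.

Lemma is_leading_digit_inj (R : realType) (b : nat) (x : R) (d e : nat) :
  (1 < b)%N -> is_leading_digit b x d -> is_leading_digit b x e -> d = e.
Proof.
move=> b1.
have b0 : (0 : R) < b%:R by rewrite ltr0n ltnW.
have bj0 j : 0 < (b%:R : R) ^ j by rewrite exprz_gt0.
have b1R : (1 : R) < b%:R by rewrite ltr1n.
have aux d1 e1 j k : (d1 < b)%N -> (1 <= e1)%N ->
    x < d1.+1%:R * b%:R ^ j -> e1%:R * b%:R ^ k <= x -> k <= j.
  move=> d1b e1_ge1 xd ex; rewrite leNgt; apply/negP; rewrite -lezD1 => jk.
  have : x < x; last by rewrite ltxx.
  apply: (lt_le_trans xd); apply: le_trans ex.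
  apply: (@le_trans _ _ (b%:R ^ (j + 1))).
    by rewrite expfzDr ?gt_eqF // expr1z mulrC ler_pM2l // ler_nat.
  apply: (@le_trans _ _ (b%:R ^ k)); first by rewrite ler_eXz2l.
  by rewrite ler_peMl ?ler1n // ltW.
have aux2 d1 e1 j : d1%:R * b%:R ^ j <= x -> x < e1.+1%:R * b%:R ^ j ->
    (d1 <= e1)%N.
  move=> dx xe; rewrite -ltnS -(ltr_nat R) -(ltr_pM2r (bj0 j)).
  exact: le_lt_trans xe.
move=> [/andP[d0 db] [j /andP[dx xd]]] [/andP[e0 eb] [k /andP[ex xe]]].
have jk : j = k by apply/eqP; rewrite eq_le (aux e d k j) // (aux d e j k).
subst k; apply/eqP; rewrite eqn_leq.
by rewrite (aux2 d e j dx xe) (aux2 e d j ex xd).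
Qed.

Lemma leading_digitP (R : realType) (b : nat) (x : R) (d : nat) :
  (1 < b)%N -> 0 < x ->
  leading_digit b x = d <-> is_leading_digit b x d.
Proof.
move=> b1 x0.
have xD : is_leading_digit b x (leading_digit b x).
  exact: xgetPex (leading_digit_exists b1 x0).
by split => [<- //|]; apply: is_leading_digit_inj.
Qed.

(* Main.v *)
Require Import Defs.
From mathcomp Require Import all_boot all_order all_algebra finmap.
From mathcomp Require Import boolp classical_sets cardinality reals.
From mathcomp Require Import zify ring lra.

(** Write b = k^2 m with k >= 2 and take a = k m = b / k.  Up to powers of b,
    multiplying by a is the same as dividing by k, so the significand in [1, b)
    of a^n follows an explicit map: y goes to y a if y < k and to y / k
    otherwise.  The leading digits are the integer parts along this orbit.

    If the orbit repeats a value it is eventually periodic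
    ([complexity_bounded]), the complexity is bounded, and it cannot equal
    c n + d with c >= 1.

    Otherwise two significands are arbitrarily close without being equal; the
    powers of their ratio advance by small multiplicative steps, so every digit
    occurs ([exists_digit]).  Now the first three complexities already exclude
    an affine function.  The explicit map shows that a digit determines its
    predecessor or its successors within certain ranges, and this gives

      p(1) <= b - 1,   p(2) >= (b - k) + (b - a),
      p(3) <= 2 (b - a) + (b - k^2)

    ([complexity1_le], [complexity2_ge], [complexity3_le]).  Hence
    2 p(2) - p(1) - p(3) >= (k - 1)^2 > 0, whereas this second difference
    vanishes for an affine function.

    The reason for this choice of a: modulo powers of b, the number k + 1 times
    a^2 is the digit (k + 1) m, while k + 1 times a is (k + 1) / k, which is not
    a digit.  So 1 / a times the cut point (k + 1) m of the digit partition is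
    a new cut point and 1 / a^2 times it is an old one, which makes
    p(3) - p(2) smaller than p(2) - p(1). *)

Import Order.TTheory GRing.Theory Num.Theory.
Local Open Scope ring_scope.

(** * Bounding the number of blocks *)

Lemma complexity_le (R : realType) (a : R) (b n : nat) (ws : seq (seq nat)) :
  (forall i, (1 <= i)%N -> lead_block a b n i \in ws) ->
  (complexity a b n <= size ws)%N.
Proof.
move=> sub; apply: uniq_leq_size; first exact: fset_uniq.
move=> w; rewrite in_fset_set; last exact: finite_lead_blocks.
by rewrite inE => -[i i1 <-]; apply: sub.
Qed.

Lemma complexity_ge (R : realType) (a : R) (b n : nat) (T : eqType)
    (g : seq nat -> T) (xs : seq T) : uniq xs ->
  (forall x, x \in xs -> exists2 i, (1 <= i)%N & g (lead_block a b n i) = x) ->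
  (size xs <= complexity a b n)%N.
Proof.
move=> xsU hit.
rewrite /complexity -(size_map g (fset_set (lead_blocks a b n))).
apply: uniq_leq_size => // x /hit.
case=> i i1 <-; apply: map_f.
rewrite in_fset_set; last exact: finite_lead_blocks.
by rewrite inE; exists i.
Qed.

(** * Two facts on archimedean fields *)

Lemma truncn_divn (R : archiRealFieldType) (x : R) (n : nat) : 0 <= x ->
  (0 < n)%N -> Num.truncn (x / n%:R) = (Num.truncn x %/ n)%N.
Proof.
move=> x0 n0; have n0R : (0 : R) < n%:R by rewrite ltr0n.
apply: truncn_def; have /andP[lo hi] := truncn_itv x0.
rewrite ler_pdivlMr // ltr_pdivrMr // -!natrM; apply/andP; split.
  by apply: le_trans lo; rewrite ler_nat leq_divM.
by apply: (lt_le_trans hi); rewrite ler_nat ltn_ceil.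
Qed.

(** The first power of r that reaches z overshoots it by a factor less than r;
    its exponent is at least 2 because r itself is still below z. *)
Lemma exists_expr_between (R : archiRealFieldType) (r z : R) :
  1 < r -> r < z -> exists2 t, (2 <= t)%N & z <= r ^+ t < z * r.
Proof.
move=> r1 rz; have r0 : 0 < r by apply: lt_trans r1.
have z0 : 0 < z by apply: lt_trans rz.
(* Bernoulli's inequality: the powers of r are unbounded. *)
have bern n : 1 + n%:R * (r - 1) <= r ^+ n.
  elim: n => [|n IH]; first by rewrite mul0r addr0 expr0.
  rewrite exprS; apply: (@le_trans _ _ (r * (1 + n%:R * (r - 1)))).
    rewrite -natr1; have : 0 <= n%:R * (r - 1) ^+ 2.
      by rewrite mulr_ge0 // sqr_ge0.
    by rewrite expr2; nra.
  by rewrite ler_pM2l.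
have zP : exists t, z <= r ^+ t.
  exists (Num.bound (z / (r - 1))); apply: le_trans (bern _).
  have r10 : 0 < r - 1 by rewrite subr_gt0.
  have /archi_boundP : 0 <= z / (r - 1) by rewrite divr_ge0 // ltW.
  by rewrite ltr_pdivrMr //; lra.
have [[|[|t]] zt tmin] := ex_minnP zP.
- by move: zt; rewrite expr0; lra.
- by move: zt; rewrite expr1; lra.
exists t.+2 => //; rewrite zt /= exprSr ltr_pM2r // ltNge.
by apply/negP => /tmin; rewrite ltnn.
Qed.

(** * The orbit of significands *)

(** Multiplication by a on significands in base a k: the product y a is at
    least the base exactly when y >= k, and then y a / (a k) = y / k. *)
Definition significand_step (R : realType) (k a : nat) (y : R) : R :=
  if y < k%:R then y * a%:R else y / k%:R.

Definition significand (R : realType) (k a n : nat) : R :=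
  iter n (significand_step R k a) 1.

Section Orbit.

Set Implicit Arguments.
Unset Strict Implicit.

Variables (R : realType) (k m : nat).
Hypotheses (k_gt1 : (1 < k)%N) (m_gt0 : (0 < m)%N).

Local Notation a := (k * m)%N.
Local Notation b := (k ^ 2 * m)%N.
Local Notation s := (significand R k a).
Local Notation digit n := (Num.truncn (s n)).

Let a_gt0 : (0 < a)%N. Proof. by rewrite muln_gt0 m_gt0 andbT ltnW. Qed.
Let b_gt1 : (1 < b)%N. Proof. nia. Qed.
Let bE : b = (a * k)%N. Proof. lia. Qed.
Let k0 : (0 : R) < k%:R. Proof. by rewrite ltr0n ltnW. Qed.
Let a0 : (0 : R) < a%:R. Proof. by rewrite ltr0n. Qed.
Let b0 : (0 : R) < b%:R. Proof. by rewrite ltr0n ltnW. Qed.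

Lemma significandS n :
  s n.+1 = if s n < k%:R then s n * a%:R else s n / k%:R.
Proof. by []. Qed.

Lemma significand_itv n : 1 <= s n < b%:R.
Proof.
elim: n => [|n /andP[lo hi]]; first by rewrite lexx ltr1n.
have s0 : 0 < s n by apply: lt_le_trans lo.
rewrite significandS; case: ltP => sk; apply/andP; split.
- by rewrite mulr_ege1 // ler1n.
- by rewrite bE (natrM _ a) mulrC ltr_pM2l.
- by rewrite ler_pdivlMr // mul1r.
- apply: le_lt_trans hi; rewrite ler_pdivrMr //.
  by rewrite ler_peMr ?ler1n ?(ltW s0) // ltnW.
Qed.

Let s0 n : 0 < s n.
Proof. by have /andP[lo _] := significand_itv n; apply: lt_le_trans lo. Qed.

Lemma exp_significand n : exists j : int, a%:R ^+ n = s n * b%:R ^ j.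
Proof.
elim: n => [|n [j IH]]; first by exists 0; rewrite expr0 expr0z mulr1.
rewrite exprSr IH significandS; case: ifP => _.
  by exists j; rewrite mulrAC.
exists (j + 1); rewrite expfzDr ?gt_eqF // expr1z bE (natrM _ a).
by field; rewrite gt_eqF.
Qed.

Lemma digit_itv n : (1 <= digit n < b)%N.
Proof.
have /andP[lo hi] := significand_itv n.
by rewrite truncn_gt0 lo truncn_lt_nat // ltW.
Qed.

Lemma leading_digit_exp n : leading_digit b (a%:R ^+ n : R) = digit n.
Proof.
apply/leading_digitP => //; first by rewrite exprn_gt0.
split; first exact: digit_itv.
have [j ->] := exp_significand n; exists j.
have bj0 : 0 < (b%:R : R) ^ j by rewrite exprz_gt0.
by rewrite ler_pM2r // ltr_pM2r // truncn_itv // ltW.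
Qed.

Lemma lead_block_exp n i :
  lead_block (a%:R : R) b n i = [seq digit (i + j) | j <- iota 0 n].
Proof. by apply: eq_map => j; rewrite leading_digit_exp. Qed.

(** * Relations between consecutive digits *)

(** From y < k the orbit goes to y a and then, as y a >= k, to y a / k; both y
    and y a / k are quotients of the middle term by an integer. *)
Lemma digitS_small n : (digit n < k)%N ->
  (digit n = digit n.+1 %/ a)%N /\ (digit n.+2 = digit n.+1 %/ k)%N.
Proof.
rewrite truncn_lt_nat ?(ltW (s0 _)) // => sk.
have s1 : s n.+1 = s n * a%:R by rewrite significandS sk.
have lo : k%:R <= s n.+1.
  have /andP[s1n _] := significand_itv n.
  by rewrite s1 natrM mulrCA ler_peMr ?(ltW k0) // mulr_ege1 // ler1n.
split; rewrite -truncn_divn ?(ltW (s0 _)) //; first by rewrite s1 mulfK ?gt_eqF.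
  by rewrite significandS ltNge lo.
exact: ltnW.
Qed.

Lemma digitS_large n : (k <= digit n)%N -> digit n.+1 = (digit n %/ k)%N.
Proof.
rewrite truncn_ge_nat ?(ltW (s0 _)) // => ks.
by rewrite significandS ltNge ks truncn_divn ?(ltW (s0 _)) // ltnW.
Qed.

(** The two branches of the step have disjoint images: [a, b) for y < k, and
    [1, a) for y >= k. *)
Lemma digitS_ge_a n : (a <= digit n.+1)%N = (digit n < k)%N.
Proof.
have /andP[d1 db] := digit_itv n.
case: (ltnP (digit n) k) => dk.
  have [dE _] := digitS_small dk.
  by rewrite leqNgt; apply/negP => /divn_small d0; rewrite dE d0 in d1.
rewrite digitS_large // leqNgt ltn_divLR ?(ltnW k_gt1) //.
by rewrite -bE db.
Qed.

(** From k <= y < k^2 the orbit goes to y / k, which is below k, and then to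
    (y / k) a = y m; now the last term determines the two before it. *)
Lemma digitSS_middle n : (k <= digit n < k ^ 2)%N ->
  [/\ (digit n = digit n.+2 %/ m)%N, (digit n.+1 = digit n.+2 %/ a)%N &
      (a <= digit n.+2 < k ^ 2 * m)%N].
Proof.
move=> /andP[kd dk2]; have k_gt0 := ltnW k_gt1.
have ks : k%:R <= s n by rewrite -truncn_ge_nat ?(ltW (s0 _)).
have s1 : s n.+1 = s n / k%:R by rewrite significandS ltNge ks.
have d1k : (digit n.+1 < k)%N.
  by rewrite digitS_large // ltn_divLR // mulnn.
have [d1E _] := digitS_small d1k.
have s2 : s n.+2 = s n * m%:R.
  rewrite significandS -(truncn_lt_nat _ (ltW (s0 _))) d1k s1 natrM.
  by field; rewrite gt_eqF.
split=> //.
  by rewrite -truncn_divn ?(ltW (s0 _)) // s2 mulfK // pnatr_eq0 -lt0n.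
by rewrite digitS_ge_a d1k; case/andP: (digit_itv n.+2).
Qed.

(** * Every digit occurs along an injective orbit *)

Lemma exp_itv_digit N d (e : int) : (0 < d < b)%N ->
  d%:R <= (a%:R : R) ^+ N * b%:R ^ e < d.+1%:R -> digit N = d.
Proof.
move=> db /andP[lo hi]; rewrite -leading_digit_exp.
apply/leading_digitP => //; first by rewrite exprn_gt0.
split=> //; exists (- e).
have be0 : 0 < (b%:R : R) ^ e by rewrite exprz_gt0.
by rewrite -invr_expz ler_pdivrMr // ltr_pdivlMr // lo hi.
Qed.

(** Pigeonhole on the integer parts of b s_i, which lie below b^2: two
    significands lie within 1 / b of each other. *)
Lemma exists_close_significands : injective s ->
  exists i j, (i < j)%N /\ [/\ s i != s j, `|s i - s j| * b%:R < 1 &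
    exists e : int, s j = s i * a%:R ^+ (j - i) * b%:R ^ e].
Proof.
move=> sI.
(* The values of h are below b^2, so h misses ord_max and is not injective. *)
pose h (i : 'I_(b * b).+1) : 'I_(b * b).+1 := inord (Num.truncn (s i * b%:R)).
have hlt i : (Num.truncn (s i * b%:R) < b * b)%N.
  have /andP[_ sb] := significand_itv i.
  rewrite truncn_lt_nat; last by rewrite mulr_ge0 // ltW.
  by rewrite (natrM _ b) ltr_pM2r.
have : ~~ injectiveb h.
  apply/negP => /injectiveP hI.
  have [i hi] : exists i, h i = ord_max.
    by exists (invF hI ord_max); rewrite f_invF.
  have := hlt i; move/(congr1 val): hi.
  by rewrite /h /= inordK ?ltnS ?(ltnW (hlt _)) // => ->; rewrite ltnn.
case/injectivePn => i [j ij /(congr1 val)].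
rewrite /h /= !inordK ?ltnS ?(ltnW (hlt _)) // => tE.
have close : `|s i - s j| * b%:R < 1.
  have nn l : 0 <= s l * b%:R by rewrite mulr_ge0 // ltW.
  have /andP[] := truncn_itv (nn i); have /andP[] := truncn_itv (nn j).
  rewrite tE -natr1 => ? ? ? ?.
  by rewrite -[b%:R]gtr0_norm // -normrM ltr_norml; apply/andP; split; lra.
have rel i' j' : (i' < j')%N ->
    exists e : int, s j' = s i' * a%:R ^+ (j' - i') * b%:R ^ e.
  move=> /ltnW ij'.
  have [e1 E1] := exp_significand i'; have [e2 E2] := exp_significand j'.
  exists (e1 - e2); move: E2; rewrite -{1}(subnKC ij') exprD E1.
  have be0 : (b%:R : R) ^ e2 != 0 by rewrite gt_eqF // exprz_gt0.
  move=> /esym/(canRL (mulfK be0)) ->.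
  rewrite expfzDr ?gt_eqF // -invr_expz.
  by rewrite [_ * _ ^ e1 * _]mulrAC !mulrA.
have [ltij|ltji|ijE] := ltngtP i j.
- exists i, j; split=> //; split=> //; last exact: rel.
  by rewrite (inj_eq sI) neq_ltn ltij.
- exists j, i; split=> //; split; last exact: rel.
    by rewrite (inj_eq sI) neq_ltn ltji.
  by rewrite distrC.
by move: ij; rewrite -val_eqE /= ijE eqxx.
Qed.

(** The ratio r > 1 of two close significands is, up to a power of b, a power
    of a or the inverse of one.  Since r < (d + 1) / d, the powers of r (of
    1 / r in the second case) cannot jump over the interval [d, d + 1) scaled
    by a suitable power of b.  The bound 2 <= n leaves room for a preceding
    digit at a positive index. *)
Lemma exists_digit d : injective s -> (0 < d < b)%N ->
  exists2 n, (2 <= n)%N & digit n = d.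
Proof.
move=> sI dlt; have /andP[d0 db] := dlt.
have [i [j [ij [neq close [e rel]]]]] := exists_close_significands sI.
have ji0 : (0 < j - i)%N by rewrite subn_gt0.
have si0 := s0 i; have sj0 := s0 j.
have bpos : (2 : R) <= b%:R by rewrite ler_nat.
have si1 : 1 <= s i by case/andP: (significand_itv i).
have sj1 : 1 <= s j by case/andP: (significand_itv j).
have d1 : (1 : R) <= d%:R by rewrite ler1n.
have dbR : (d%:R + 1 : R) <= b%:R by rewrite natr1 ler_nat.
have ratio (x y : R) : 1 <= x -> x < y -> `|x - y| * b%:R < 1 ->
    [/\ 1 < y / x, y / x < 2 & y / x * d%:R < d%:R + 1].
  move=> x1 xy; rewrite ltr0_norm ?subr_lt0 // opprB => c.
  have x0 : 0 < x by apply: lt_le_trans x1.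
  have q1 : 1 < y / x by rewrite ltr_pdivlMr // mul1r.
  have qb : (y / x - 1) * b%:R < 1.
    apply: le_lt_trans c; rewrite ler_pM2r //.
    have -> : y / x - 1 = (y - x) / x by rewrite mulrBl divff ?gt_eqF.
    by rewrite ler_pdivrMr // ler_peMr // subr_ge0 ltW.
  have small z : z <= b%:R -> (y / x - 1) * z < 1.
    by move=> zb; apply: le_lt_trans qb; rewrite ler_pM2l // subr_gt0.
  split=> //; first by have := small _ bpos; lra.
  have /small : d%:R <= b%:R :> R by lra.
  by rewrite mulrBl mul1r; lra.
have relX t : (s j / s i) ^+ t = a%:R ^+ ((j - i) * t) * b%:R ^ (e * t%:Z).
  rewrite rel -(mulrA (s i)) [s i * _]mulrC mulfK ?gt_eqF //.
  by rewrite exprMn exprM; congr (_ * _); rewrite exprnP exprz_exp.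
(* If s i < s j, some r^t is in [d b, (d + 1) b). *)
have [ltij|leji] := ltP (s i) (s j).
  have [r1 r2 rd] := ratio _ _ si1 ltij close.
  set r := s j / s i in r1 r2 rd relX.
  have rz : r < d%:R * b%:R.
    by apply: (lt_le_trans r2); apply: (le_trans bpos); rewrite ler_peMl // ltW.
  have [t t2 /andP[lo hi]] := exists_expr_between _ _ _ r1 rz.
  exists ((j - i) * t)%N; first exact: leq_trans t2 (leq_pmull _ ji0).
  apply: (@exp_itv_digit _ _ (e * t%:Z - 1)) => //.
  rewrite expfzDr ?gt_eqF // -invr_expz expr1z mulrA -relX.
  rewrite ler_pdivlMr // ltr_pdivrMr // lo /=.
  by apply: (lt_trans hi); rewrite mulrAC ltr_pM2r // -natr1 mulrC.
(* If s j < s i, then r = s i / s j and some r^-t is in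
   [d / b^2, (d + 1) / b^2): take the first r^t that reaches b^2 / (d r). *)
have ltji : s j < s i by rewrite lt_neqAle eq_sym neq.
rewrite distrC in close.
have [r1 r2 rd] := ratio _ _ sj1 ltji close.
set r := s i / s j in r1 r2 rd.
have r0 : 0 < r by apply: lt_trans r1.
have dpos : 0 < (d%:R : R) by rewrite ltr0n.
pose z : R := b%:R ^+ 2 / (d%:R * r).
have dr0 : 0 < d%:R * r by rewrite mulr_gt0.
have rz : r < z.
  rewrite /z ltr_pdivlMr // mulrA expr2.
  have rdb : r * d%:R < b%:R by apply: lt_le_trans dbR.
  have rb : r < b%:R by apply: lt_le_trans bpos.
  have rd0 : 0 <= r * d%:R by rewrite mulr_ge0 // ltW.
  by rewrite ltr_pM // ltW.
have [t t2 /andP[lo hi]] := exists_expr_between _ _ _ r1 rz.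
exists ((j - i) * t)%N; first exact: leq_trans t2 (leq_pmull _ ji0).
apply: (@exp_itv_digit _ _ (e * t%:Z + 2)) => //.
have rt0 : 0 < r ^+ t by rewrite exprn_gt0.
rewrite expfzDr ?gt_eqF // mulrA -relX.
have -> : s j / s i = r^-1 by rewrite /r invf_div.
have hid : d%:R * r ^+ t < b%:R ^+ 2.
  have zr : z * r = b%:R ^+ 2 / d%:R by rewrite /z; field; rewrite !gt_eqF.
  by move: hi; rewrite zr ltr_pdivlMr // mulrC.
have lod : b%:R ^+ 2 < (d%:R + 1) * r ^+ t.
  move: lo; rewrite ler_pdivrMr // => /le_lt_trans; apply.
  by rewrite mulrC ltr_pM2r // mulrC.
rewrite exprVn mulrC -exprnP ler_pdivlMr // ltr_pdivrMr // -natr1.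
by rewrite ltW.
Qed.

(** * The first three values of the complexity *)

Lemma complexity1_le : (complexity (a%:R : R) b 1 <= b.-1)%N.
Proof.
rewrite -[leqRHS](size_iota 1) -(size_map (fun d => [:: d])).
apply: complexity_le => i _.
rewrite lead_block_exp /= addn0; apply: map_f; rewrite mem_iota.
have := digit_itv i; lia.
Qed.

(** A block vw with v >= k is identified by v, and one with v < k by w, which
    then ranges over the digits w >= a.  As every digit occurs, all these
    values are reached. *)
Lemma complexity2_ge : injective s ->
  ((b - k) + (b - a) <= complexity (a%:R : R) b 2)%N.
Proof.
move=> sI.
pose g (w : seq nat) : nat :=
  if (k <= nth 0 w 0)%N then nth 0%N w 0 else (b + nth 0 w 1)%N.
have kb : (k <= b)%N by nia.
have ab : (a <= b)%N by nia.
rewrite -(size_iota k (b - k)) -(size_iota (b + a) (b - a)) -size_cat.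
apply: (@complexity_ge _ _ _ _ _ g).
  rewrite cat_uniq !iota_uniq andbT /=; apply/hasPn => x.
  by rewrite !mem_iota; lia.
move=> x; rewrite mem_cat !mem_iota => /orP[xk|xa].
  have [|i i2 di] := @exists_digit x sI; first lia.
  exists i; first lia.
  by rewrite lead_block_exp /g /= addn0 di; case: ifP; lia.
have [|[|i] i2 di] // := @exists_digit (x - b) sI; first lia.
have dk : (digit i < k)%N by rewrite -digitS_ge_a di; lia.
exists i => //; rewrite lead_block_exp /g /= addn0 addn1 di leqNgt dk /=; lia.
Qed.

(** A block uvw is determined by v if u < k, by w if k <= u < k^2, and by u if
    u >= k^2. *)
Lemma complexity3_le :
  (complexity (a%:R : R) b 3 <= (b - a) + ((b - a) + (b - k ^ 2)))%N.
Proof.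
pose w1 i := [:: i %/ a; i; i %/ k]%N.
pose w2 i := [:: i %/ m; i %/ a; i]%N.
pose w3 i := [:: i; i %/ k; i %/ k %/ k]%N.
rewrite -[X in (_ <= X + (X + _))%N](size_iota a).
rewrite -[X in (_ <= _ + (_ + X))%N](size_iota (k ^ 2)).
rewrite -{1}(size_map w1) -(size_map w2) -(size_map w3) -!size_cat.
apply: complexity_le => i _.
rewrite lead_block_exp /= addn0 addn1 addn2 !mem_cat.
have ab : (a <= b)%N by nia.
have := digit_itv i; have := digit_itv i.+1; have := digit_itv i.+2 => d2 d1 d0.
have [dk|kd] := ltnP (digit i) k.
  have [E0 E2] := digitS_small dk; rewrite E2 {1}E0.
  apply/orP; left; apply: (map_f w1); rewrite mem_iota.
  by have := digitS_ge_a i; rewrite dk; lia.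
have [dk2|k2d] := ltnP (digit i) (k ^ 2).
  have [|E0 E1 itv] := @digitSS_middle i; first by rewrite kd.
  rewrite E1 E0; apply/orP; right; apply/orP; left.
  by apply: (map_f w2); rewrite mem_iota; lia.
have E1 := digitS_large kd.
have kd1 : (k <= digit i.+1)%N by rewrite E1 leq_divRL ?mulnn // ltnW.
rewrite (digitS_large kd1) E1; apply/orP; right; apply/orP; right.
by apply: (map_f w3); rewrite mem_iota; lia.
Qed.

(** * Periodic orbits and conclusion *)

(** A repeated significand makes the orbit eventually periodic, since each
    significand depends on the previous one only. *)
Lemma complexity_bounded : ~ injective s ->
  exists N, forall n, (complexity (a%:R : R) b n <= N)%N.
Proof.
move=> /existsNP[i0 /existsNP[j0 /not_implyP[Eij neq]]].
have [i [j [ij sij]]] : exists i j, (i < j)%N /\ s i = s j.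
  by case: (ltngtP i0 j0) => [?|?|//]; [exists i0, j0|exists j0, i0].
have shift l : s (i + l)%N = s (j + l)%N.
  by rewrite /significand ![(_ + l)%N]addnC !iterD -!/(significand _ _ _ _) sij.
(* Every tail of the orbit is a tail that starts before j. *)
have per q : exists2 l, (l < j)%N & forall t, s (q + t)%N = s (l + t)%N.
  have [n] := ubnP q; elim: n q => // n IH q qn.
  have [qj|jq] := ltnP q j; first by exists q.
  have [|l lj E] := IH (i + (q - j))%N; first by lia.
  exists l => // t; rewrite -E -addnA shift; congr s; lia.
exists j => n.
rewrite -[j in leqRHS](size_iota 0) -(size_map (lead_block (a%:R : R) b n)).
apply: complexity_le => q _; have [l lj E] := per q.
apply/mapP; exists l; first by rewrite mem_iota.
by rewrite !lead_block_exp; apply: eq_map => t; rewrite E.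
Qed.

Lemma complexity_not_affine (c d : int) : 1 <= c ->
  ~ forall n : nat, (1 <= n)%N ->
      (complexity (a%:R : R) b n)%:Z = c * n%:Z + d.
Proof.
move=> c1 aff; have [sI|sI] := pselect (injective s).
  (* (k - 1)^2 > 0 enters as 2 k <= k^2. *)
  have := complexity1_le; have := complexity2_ge sI; have := complexity3_le.
  have := aff 1%N isT; have := aff 2%N isT; have := aff 3%N isT.
  have k2 : (k * 2 <= k ^ 2)%N by rewrite -mulnn leq_mul2l k_gt1 orbT.
  have ab : (a * 2 <= b)%N by nia.
  have kb : (k ^ 2 <= b)%N by nia.
  lia.
have [N bound] := complexity_bounded sI.
have := aff (N + `|d|).+1%N isT; have := bound (N + `|d|).+1%N.
nia.
Qed.

End Orbit.

Theorem corollary2p4 (R : realType) (b : nat) (b_ge5 : (5 <= b)%N)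
    (b_nsqf : ~ squarefree b) :
  exists a : nat, (1 < a < b)%N /\
    ~ exists c d : int, 1 <= c /\
        forall n : nat, (1 <= n)%N ->
          (complexity (a%:R : R) b n)%:Z = c * n%:Z + d.
Proof.
have [k /not_implyP[/dvdnP[m bE] k1]] : exists k, ~ ((k ^ 2 %| b)%N -> k = 1%N).
  exact/existsNP.
have k_gt1 : (1 < k)%N by case: k bE k1 => [|[|k]] // bE; lia.
have m_gt0 : (0 < m)%N by lia.
rewrite mulnC in bE; exists (k * m)%N; split; first by rewrite bE; nia.
case=> c [d [c1]]; rewrite bE; exact: complexity_not_affine.
Qed.
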